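(* Let $(A,\mu,T)$ be a Rota-Baxter algebra of weight $\lambda$. If $\mathrm{H}^2_{\mathrm{RBA}_\lambda}(A)=0$, then $(A,\mu,T)$ is rigid, i.e. every $1$-parameter formal deformation of $(A,\mu,T)$ is trivial.
   Context: $\mathbf{k}$ is a field of characteristic $0$, $\lambda\in\mathbf{k}$; everything is over $\mathbf{k}$. A Rota-Baxter algebra of weight $\lambda$ is $(A,\mu=\cdot,T)$ with $(A,\mu)$ associative and $T:A\to A$ linear with $T(a)T(b)=T(aT(b)+T(a)b+\lambda ab)$. Write $a_{i,j}=a_i\otimes\cdots\otimes a_j$ (empty if $i>j$). **Formal deformation.** For linear maps $\mu_i:A\otimes A\to A$ and $T_i:A\to A$ ($i\geqslant0$), the pair $(\mu_t=\sum\mu_it^i,T_t=\sum T_it^i)$ is a $1$-parameter formal deformation of $(A,\mu,T)$ if (extended $\mathbf{k}[[t]]$-linearly) it makes the $\mathbf{k}[[t]]$-module $A[[t]]$ into a Rota-Baxter algebra of weight $\lambda$ over $\mathbf{k}[[t]]$ and $(\mu_0,T_0)=(\mu,T)$. A formal isomorphism from $(A[[t]],\mu'_t,T'_t)$ to $(A[[t]],\mu_t,T_t)$ is a power series $\psi_t=\sum_{i\geqslant0}\psi_it^i$ with $\psi_i:A\to A$ linear, $\psi_0=\mathrm{Id}_A$, such that $\psi_t\circ\mu'_t=\mu_t\circ(\psi_t\otimes\psi_t)$ and $\psi_t\circ T_t'=T_t\circ\psi_t$; if one exists the deformations are called equivalent. A deformation is trivial if it is equivalent to the one with $\mu_i=0$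 and $T_i=0$ for all $i\geqslant1$. **Cochain complex.** Let $\mathrm{C}^n_{\mathrm{Alg}}(A)=\mathrm{C}^n_{\mathrm{RBO}_\lambda}(A)=\mathrm{Hom}(A^{\otimes n},A)$, $n\geqslant0$. - $\delta^n(f)(a_{1,n+1})=(-1)^{n+1}a_1f(a_{2,n+1})+\sum_{i=1}^n(-1)^{n-i+1}f(a_{1,i-1}\otimes a_ia_{i+1}\otimes a_{i+2,n+1})+f(a_{1,n})a_{n+1}$. - With $a\star b=aT(b)+T(a)b+\lambda ab$, $a\rhd x=T(a)x-T(ax)$, $x\lhd a=xT(a)-T(xa)$: $\partial^n(f)(a_{1,n+1})=(-1)^{n+1}a_1\rhd f(a_{2,n+1})+\sum_{i=1}^n(-1)^{n-i+1}f(a_{1,i-1}\otimes a_i\star a_{i+1}\otimes a_{i+2,n+1})+f(a_{1,n})\lhd a_{n+1}$. - $\Phi^0=\mathrm{Id}$ and for $n\geqslant1$: $\Phi^n(f)(a_{1,n})=f(T(a_1)\otimes\cdots\otimes T(a_n))-\sum_{k=0}^{n-1}\lambda^{n-k-1}\sum_{1\leqslant i_1<\cdots<i_k\leqslant n}T\circ f(a_{1,i_1-1}\otimes T(a_{i_1})\otimes a_{i_1+1,i_2-1}\otimes T(a_{i_2})\otimes\cdots\otimes T(a_{i_k})\otimes a_{i_k+1,n})$. - $\mathrm{C}^0_{\mathrm{RBA}_\lambda}(A)=\mathrm{C}^0_{\mathrm{Alg}}(A)$, $\mathrm{C}^n_{\mathrm{RBA}_\lambda}(A)=\mathrm{C}^n_{\mathrm{Alg}}(A)\oplus\mathrm{C}^{n-1}_{\mathrm{RBO}_\lambda}(A)$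 for $n\geqslant1$, with $d^n(f,g)=(\delta^n(f),-\partial^{n-1}(g)-\Phi^n(f))$. Its cohomology is $\mathrm{H}^\bullet_{\mathrm{RBA}_\lambda}(A)$. *)

(* Defs.v *)
From HB Require Import structures.
From mathcomp Require Import all_boot all_order all_algebra.
From mathcomp Require Import boolp functions.
Set Implicit Arguments.
Unset Strict Implicit.
Unset Printing Implicit Defensive.
Import GRing.Theory.
Local Open Scope ring_scope.

Section RotaBaxter.
Variables (R : comNzRingType) (V : lmodType R) (lam : R).
Variables (mu : V -> V -> V) (T : V -> V).

Definition rota_baxter : Prop :=
  [/\ bilinear_for *:%R *:%R mu,
      associative mu,
      linear T
    & forall a b, mu (T a) (T b) = T (mu a (T b) + mu (T a) b + lam *: mu a b)].

End RotaBaxter.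

(* [fps V] is V[[t]], a series being its sequence of coefficients. *)
Definition fps (V : Type) : Type := nat -> V.

HB.instance Definition _ (V : zmodType) := GRing.Zmodule.on (fps V).

Definition cauchy (U V W : zmodType) (op : U -> V -> W)
    (x : fps U) (y : fps V) : fps W :=
  fun n => \sum_(i < n.+1) op (x i) (y (n - i)%N).

Definition fps_const (V : zmodType) (c : V) : fps V :=
  fun n => if n is 0 then c else 0.

Lemma fps_addE (V : zmodType) (x y : fps V) n : (x + y) n = x n + y n.
Proof. by []. Qed.

Lemma sum_triangle (V : zmodType) n (F : nat -> nat -> nat -> V) :
  \sum_(i < n.+1) \sum_(j < (n - i).+1) F i j (n - i - j)%N =
  \sum_(m < n.+1) \sum_(i < m.+1) F i (m - i)%N (n - m)%N.
Proof.
transitivity (\sum_(i < n.+1) \sum_(m < n.+1 | (i <= m)%N)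
                 F i (m - i)%N (n - m)%N).
  apply: eq_bigr => i _; rewrite -(big_mkord (fun m => (i <= m)%N)
    (fun m => F i (m - i)%N (n - m)%N)).
  rewrite -(big_nat_widenl i 0 n.+1 predT) //.
  transitivity (\sum_(0 + i <= m < n.+1) F i (m - i)%N (n - m)%N); last by rewrite add0n.
  rewrite big_addn subSn ?big_mkord; last by rewrite -ltnS.
  by apply: eq_bigr => j _; rewrite addnK addnC subnDA.
rewrite (exchange_big_dep predT) //=; apply: eq_bigr => m _.
by rewrite (big_ord_widen_cond n.+1 predT
  (fun i => F i (m - i)%N (n - m)%N)) //=; apply: eq_bigl => i; rewrite ltnS.
Qed.

Section FpsRing.
Variable R : comNzRingType.
Implicit Types a b c : fps R.

Definition fps_mul : fps R -> fps R -> fps R := cauchy *%R.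

Lemma fps_mulA : associative fps_mul.
Proof.
move=> a b c; apply/funext => n; rewrite /fps_mul /cauchy.
under eq_bigr do rewrite mulr_sumr.
rewrite (sum_triangle n (fun i j l => a i * (b j * c l))).
by apply: eq_bigr => m _; rewrite mulr_suml; apply: eq_bigr => i _; rewrite mulrA.
Qed.

Lemma fps_mulC : commutative fps_mul.
Proof.
move=> a b; apply/funext => n; rewrite /fps_mul /cauchy.
rewrite (reindex_inj rev_ord_inj) /=; apply: eq_bigr => i _.
by rewrite subSS mulrC subKn // -ltnS.
Qed.

Lemma fps_mul1 : left_id (fps_const 1) fps_mul.
Proof.
move=> a; apply/funext => n; rewrite /fps_mul /cauchy big_ord_recl subn0 mul1r.
by rewrite big1 ?addr0 // => i _; rewrite mul0r.
Qed.

Lemma fps_mulDl : left_distributive fps_mul +%R.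
Proof.
move=> a b c; apply/funext => n.
by rewrite fps_addE /fps_mul /cauchy -big_split /=; apply: eq_bigr => i _; rewrite mulrDl.
Qed.

Lemma fps_const1_neq0 : fps_const (1 : R) != 0.
Proof. by apply/eqP => /(congr1 (fun a : fps R => a 0%N)) /eqP; rewrite oner_eq0. Qed.

HB.instance Definition _ := GRing.Zmodule_isComNzRing.Build (fps R)
  fps_mulA fps_mulC fps_mul1 fps_mulDl fps_const1_neq0.

Variable V : lmodType R.
Implicit Types x y : fps V.

Definition fps_scale : fps R -> fps V -> fps V := cauchy *:%R.

Lemma fps_scaleA a b x : fps_scale a (fps_scale b x) = fps_scale (a * b) x.
Proof.
apply/funext => n; rewrite /fps_scale /cauchy.
under eq_bigr do rewrite scaler_sumr.
rewrite (sum_triangle n (fun i j l => a i *: (b j *: x l))).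
by apply: eq_bigr => m _; rewrite scaler_suml; apply: eq_bigr => i _; rewrite scalerA.
Qed.

Lemma fps_scale1 : left_id 1 fps_scale.
Proof.
move=> x; apply/funext => n; rewrite /fps_scale /cauchy big_ord_recl subn0 scale1r.
by rewrite big1 ?addr0 // => i _; rewrite scale0r.
Qed.

Lemma fps_scaleDr : right_distributive fps_scale +%R.
Proof.
move=> a x y; apply/funext => n.
by rewrite fps_addE /fps_scale /cauchy -big_split /=; apply: eq_bigr => i _; rewrite scalerDr.
Qed.

Lemma fps_scaleDl x : {morph fps_scale^~ x : a b / a + b}.
Proof.
move=> a b; apply/funext => n.
by rewrite fps_addE /fps_scale /cauchy -big_split /=; apply: eq_bigr => i _; rewrite scalerDl.
Qed.

HB.instance Definition _ := GRing.Zmodule_isLmodule.Build (fps R) (fps V)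
  fps_scaleA fps_scale1 fps_scaleDr fps_scaleDl.

End FpsRing.

Section Extension.
Variable V : zmodType.

Definition ext1 (F : nat -> V -> V) : fps V -> fps V := cauchy id F.

(* The coefficient of t^n in mu_t(x, y) is the sum of mu_i(x_j, y_l) over
   i + j + l = n. *)
Definition ext2 (F : nat -> V -> V -> V) (x y : fps V) : fps V :=
  fun n => \sum_(i < n.+1) cauchy (F i) x y (n - i)%N.

End Extension.

Section Deformation.
Variables (k : fieldType) (A : lmodType k) (lam : k).

Definition formal_deformation (mu : A -> A -> A) (T : A -> A)
    (mu_ : nat -> A -> A -> A) (T_ : nat -> A -> A) : Prop :=
  [/\ forall i, bilinear_for *:%R *:%R (mu_ i),
      forall i, linear (T_ i),
      @rota_baxter (fps k) (fps A) (fps_const lam) (ext2 mu_) (ext1 T_),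
      mu_ 0%N = mu
    & T_ 0%N = T].

Definition formal_isomorphism (psi_ : nat -> A -> A)
    (mu'_ : nat -> A -> A -> A) (T'_ : nat -> A -> A)
    (mu_ : nat -> A -> A -> A) (T_ : nat -> A -> A) : Prop :=
  [/\ forall i, linear (psi_ i),
      psi_ 0%N = id,
      forall x y, ext1 psi_ (ext2 mu'_ x y) = ext2 mu_ (ext1 psi_ x) (ext1 psi_ y)
    & forall x, ext1 psi_ (ext1 T'_ x) = ext1 T_ (ext1 psi_ x)].

Definition equivalent_deformations
    (mu'_ : nat -> A -> A -> A) (T'_ : nat -> A -> A)
    (mu_ : nat -> A -> A -> A) (T_ : nat -> A -> A) : Prop :=
  exists psi_, formal_isomorphism psi_ mu'_ T'_ mu_ T_.

Definition trivial_deformation (mu : A -> A -> A) (T : A -> A)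
    (mu_ : nat -> A -> A -> A) (T_ : nat -> A -> A) : Prop :=
  equivalent_deformations mu_ T_
    (fun i => if i is 0 then mu else fun _ _ => 0)
    (fun i => if i is 0 then T else fun _ => 0).

Definition rigid (mu : A -> A -> A) (T : A -> A) : Prop :=
  forall mu_ T_, formal_deformation mu T mu_ T_ -> trivial_deformation mu T mu_ T_.

End Deformation.

Section Complex.
Variables (k : fieldType) (A : lmodType k) (lam : k).
Variables (mu : A -> A -> A) (T : A -> A).

Notation tensor n := {ffun 'I_n -> A}.

(* Hom(A^{\otimes n}, A) is the set of functions on n-families satisfying
   [multilinear]; for n = 0 every function qualifies, giving Hom(k, A) = A. *)
Definition multilinear n (f : tensor n -> A) : Prop :=
  forall (a : tensor n) (i : 'I_n),
    linear (fun x : A => f [ffun j => if j == i then x else a j]).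

Definition merge (op : A -> A -> A) n (i : 'I_n) (a : tensor n.+1) : tensor n :=
  [ffun j : 'I_n =>
     if (j < i)%N then a (widen_ord (leqnSn n) j)
     else if j == i then op (a (widen_ord (leqnSn n) j)) (a (lift ord0 j))
     else a (lift ord0 j)].

(* Families are indexed from 0, so the sign of the i-th inner term is
   (-1)^{n-i} instead of (-1)^{n-i+1}. *)
Definition hochschild (op lact ract : A -> A -> A) n
    (f : tensor n -> A) : tensor n.+1 -> A :=
  fun a =>
    (-1) ^+ n.+1 *: lact (a ord0) (f [ffun j => a (lift ord0 j)])
    + \sum_(i < n) (-1) ^+ (n - i) *: f (merge op i a)
    + ract (f [ffun j => a (widen_ord (leqnSn n) j)]) (a ord_max).

Definition delta := hochschild mu mu mu.

Definition star a b := mu a (T b) + mu (T a) b + lam *: mu a b.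
Definition rhd a x := mu (T a) x - T (mu a x).
Definition lhd x a := mu x (T a) - T (mu x a).

Definition partial := hochschild star rhd lhd.

(* The positions i_1 < ... < i_k at which T is applied form a k-subset S. *)
Definition Phi n (f : tensor n -> A) : tensor n -> A :=
  fun a =>
    if n is 0 then f a else
      f [ffun j => T (a j)]
      - \sum_(l < n) lam ^+ (n - l - 1) *:
          \sum_(S : {set 'I_n} | #|S| == l)
             T (f [ffun j => if j \in S then T (a j) else a j]).

Definition rba_space n : Type :=
  if n is m.+1 then ((tensor m.+1 -> A) * (tensor m -> A))%type
  else tensor 0 -> A.

Definition rba_cochain n : rba_space n -> Prop :=
  match n with
  | 0 => fun f => multilinear f
  | m.+1 => fun c => multilinear c.1 /\ multilinear c.2
  end.

Definition rba_diff n : rba_space n -> rba_space n.+1 :=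
  match n with
  | 0 => fun f => (delta f, fun a => - Phi f a)
  | m.+1 => fun c => (delta c.1, fun a => - partial c.2 a - Phi c.1 a)
  end.

Definition rba_cocycle n (c : rba_space n) : Prop :=
  rba_cochain c /\ rba_diff c = (fun _ => 0, fun _ => 0).

Definition rba_coboundary n : rba_space n -> Prop :=
  match n with
  | 0 => fun c => c = fun _ => 0
  | m.+1 => fun c => exists2 b : rba_space m, rba_cochain b & rba_diff b = c
  end.

(* H^n = 0: the quotient of the cocycles by the coboundaries is zero. *)
Definition rba_cohomology_zero n : Prop :=
  forall c : rba_space n, rba_cocycle c -> rba_coboundary c.

End Complex.

(* Main.v *)
Require Import Defs.
From HB Require Import structures.
From mathcomp Require Import all_boot all_order all_algebra.
From mathcomp Require Import ssrAC boolp.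
Set Implicit Arguments.
Unset Strict Implicit.
Unset Printing Implicit Defensive.
Import GRing.Theory.
Local Open Scope ring_scope.

(** The idea is to build the equivalence [psi_t = id + psi_1 t + ...] to the
    constant deformation one coefficient at a time.  A series of linear maps
    [psi] with [psi_0 = id] has two defects, measuring how far it is from an
    isomorphism:
      [D(x, y) = psi (mu_t (x, y)) - mu (psi x, psi y)]  and
      [G(x) = psi (T_t x) - T (psi x)].
    Both are linear in each argument over the power series ring, so if they
    vanish modulo [t^n], their coefficients of [t^n] depend only on the constant
    terms of the arguments; this gives a bilinear map [E] and a linear map [F] on [A]
    ([obstruction2E], [obstruction1E]).  Reading the associativity of [mu_t] and
    the Rota-Baxter identity of [T_t] at order [n] says exactly that [(E, F)] is
    a 2-cocycle ([obstruction_cocycle]).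

    As the second cohomology vanishes, [(E, F)] is the coboundary of some pair
    [(b, c)] with [b] a linear endomorphism and [c] an element of [A].  The
    element can be absorbed: since [Phi^1 (delta^0 c) = partial^0 c] and
    [delta^1 (delta^0 c) = 0], the pairs [(b, c)] and [(b + delta^0 c, 0)] have
    the same coboundary.  Hence [E = delta^1 h] and [F = T h - h T] for
    [h = b + delta^0 c] ([primitive_exists]).  Adding [h] to [psi_n] changes the
    coefficients of [t^n] of the two defects by [- delta^1 h] and [h T - T h]
    and leaves the lower ones alone, so both defects now vanish modulo [t^(n+1)]
    ([solve_step]).  The coefficients chosen so far never change afterwards, so
    the process converges coefficientwise to a series without any defect
    ([full_solution]).

    Correcting the coefficients of a single series takes the place of composing
    infinitely many isomorphisms [id + h t^n] and transporting the deformation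
    along each of them. *)

(** * Linear maps given as plain functions *)

Section LinearFunctions.
Variables (R : nzRingType) (V W : lmodType R) (f : V -> W) (fL : linear f).

Let F : {linear V -> W} :=
  HB.pack_for {linear V -> W} f (GRing.isLinear.Build R V W *:%R f fL).

Lemma linear_fun0 : f 0 = 0. Proof. exact: (linear0 F). Qed.
Lemma linear_funD : {morph f : x y / x + y}. Proof. exact: (linearD F). Qed.
Lemma linear_funB : {morph f : x y / x - y}. Proof. exact: (linearB F). Qed.
Lemma linear_funZ c : {morph f : x / c *: x}. Proof. exact: (linearZZ F). Qed.
Lemma linear_fun_sum n (x : 'I_n -> V) : f (\sum_i x i) = \sum_i f (x i).
Proof. exact: (linear_sum F). Qed.

End LinearFunctions.

Lemma linear_sub_fun (R : nzRingType) (V W : lmodType R) (f g : V -> W) :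
  linear f -> linear g -> linear (fun x => f x - g x).
Proof.
move=> fL gL c x y; rewrite fL gL scalerBr opprD.
by rewrite [LHS](AC (2*2) ((1*3)*(2*4))).
Qed.

Lemma linear_comp_fun (R : nzRingType) (U V W : lmodType R)
    (f : V -> W) (g : U -> V) :
  linear f -> linear g -> linear (fun x => f (g x)).
Proof. by move=> fL gL c x y; rewrite gL fL. Qed.

(** * Cauchy products *)

Lemma cauchy_flip (U V W : zmodType) (op : U -> V -> W)
    (x : fps U) (y : fps V) :
  cauchy op x y = cauchy (fun v u => op u v) y x.
Proof.
apply/funext => n; rewrite /cauchy (reindex_inj rev_ord_inj) /=.
by apply: eq_bigr => i _; rewrite subSS subKn // -ltnS.
Qed.

(** The two ways of splitting off one of three indices of fixed total; this lets
    a scalar series be pulled out of the right factor of a product. *)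
Lemma sum_triangle_exchange (V : zmodType) n (F : nat -> nat -> nat -> V) :
  \sum_(i < n.+1) \sum_(j < (n - i).+1) F i j (n - i - j)%N =
  \sum_(j < n.+1) \sum_(i < (n - j).+1) F i j (n - j - i)%N.
Proof.
rewrite sum_triangle (sum_triangle n (fun j i l => F i j l)).
apply: eq_bigr => m _; rewrite (reindex_inj rev_ord_inj) /=.
by apply: eq_bigr => i _; rewrite subSS subKn // -ltnS.
Qed.

(** Linearity over the whole power series ring: [op] may vary with the
    coefficients of [x], which covers both the constant multiplication and the
    action of a series of linear maps. *)
Lemma cauchy_linearr (R : comNzRingType) (U : zmodType) (V W : lmodType R)
    (op : U -> V -> W) (x : fps U) :
  (forall i, linear (op (x i))) ->
  linear_for (@GRing.scale (fps R) (fps W)) (cauchy op x : fps V -> fps W).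
Proof.
move=> opL a y z; apply/funext => n; rewrite fps_addE.
transitivity (\sum_(i < n.+1)
    (op (x i) ((a *: y : fps V) (n - i)%N) + op (x i) (z (n - i)%N))).
  by apply: eq_bigr => i _; rewrite -(linear_funD (opL i)) -fps_addE.
rewrite big_split /=; congr (_ + _).
transitivity (\sum_(i < n.+1) \sum_(j < (n - i).+1)
                a j *: op (x i) (y (n - i - j)%N)).
  apply: eq_bigr => i _; rewrite (linear_fun_sum (opL i)).
  by apply: eq_bigr => j _; rewrite (linear_funZ (opL i)).
rewrite (sum_triangle_exchange n (fun i j l => a j *: op (x i) (y l))).
by apply: eq_bigr => j _; rewrite -scaler_sumr.
Qed.

Lemma cauchy_linearl (R : comNzRingType) (V : zmodType) (U W : lmodType R)
    (op : U -> V -> W) (y : fps V) :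
  (forall i, linear (op^~ (y i))) ->
  linear_for (@GRing.scale (fps R) (fps W))
             ((cauchy op)^~ y : fps U -> fps W).
Proof.
move=> opL a x z; rewrite !(cauchy_flip op).
exact: (cauchy_linearr (op := fun v u => op u v) opL).
Qed.

Lemma cauchy_assoc (V : zmodType) (op : V -> V -> V) :
  (forall v, {morph op v : x y / x + y}) ->
  (forall v, {morph op^~ v : x y / x + y}) ->
  associative op -> associative (cauchy op).
Proof.
move=> opDr opDl opA x y z; apply/funext => n; rewrite /cauchy.
have op0r v : op v 0 = 0 by apply: (addrI (op v 0)); rewrite -opDr !addr0.
have op0l v : op 0 v = 0 by apply: (addrI (op 0 v)); rewrite -opDl !addr0.
transitivity (\sum_(i < n.+1) \sum_(j < (n - i).+1)
                 op (x i) (op (y j) (z (n - i - j)%N))).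
  by apply: eq_bigr => i _; apply: big_morph.
rewrite (sum_triangle n (fun i j l => op (x i) (op (y j) (z l)))).
apply: eq_bigr => m _; rewrite (big_morph _ (opDl _) (op0l _)).
by apply: eq_bigr => i _; rewrite opA.
Qed.

(** * Leading coefficients of linear maps between power series modules *)

Lemma fps_subE (V : zmodType) (x y : fps V) n : (x - y) n = x n - y n.
Proof. by []. Qed.

Section Vanish.
Variable V : zmodType.
Implicit Types x y : fps V.

Definition vanish n x : Prop := forall m, (m < n)%N -> x m = 0.

Lemma vanishW m n x : (m <= n)%N -> vanish n x -> vanish m x.
Proof. by move=> le_mn x0 l lt_lm; apply/x0/(leq_trans lt_lm). Qed.

Lemma vanishD n x y : vanish n x -> vanish n y -> vanish n (x + y).
Proof. by move=> x0 y0 m lt_mn; rewrite fps_addE x0 ?y0 ?addr0. Qed.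

Lemma vanishB n x y : vanish n x -> vanish n y -> vanish n (x - y).
Proof. by move=> x0 y0 m lt_mn; rewrite fps_subE x0 ?y0 ?subr0. Qed.

End Vanish.

Section Leading.
Variable R : comNzRingType.

Definition fps_t : fps R := fun n => (n == 1%N)%:R.

Lemma fps_const_scaleE (V : lmodType R) (c : R) (x : fps V) n :
  (fps_const c *: x) n = c *: x n.
Proof.
rewrite [LHS]big_ord_recl subn0 big1 ?addr0 // => i _.
by rewrite scale0r.
Qed.

Lemma fps_t_scaleE (V : lmodType R) (x : fps V) n :
  (fps_t *: x) n = if n is m.+1 then x m else 0.
Proof.
case: n => [|n]; first by rewrite [LHS]big_ord1 scale0r.
rewrite [LHS]big_ord_recl big_ord_recl /= scale0r add0r scale1r subSS subn0.
by rewrite big1 ?addr0 // => i _; rewrite scale0r.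
Qed.

Lemma fps_split (V : lmodType R) (x : fps V) :
  x = fps_t *: ((fun n => x n.+1) : fps V) + fps_const (x 0%N).
Proof.
apply/funext => n; rewrite fps_addE fps_t_scaleE.
by case: n => [|n]; rewrite ?add0r ?addr0.
Qed.

(** Splitting off the constant term leaves [t] times a series, whose image has
    no coefficient of order [n] because [L] commutes with [t]. *)
Lemma leading_coef (V W : lmodType R) (L : fps V -> fps W) n :
  linear_for (@GRing.scale (fps R) (fps W)) L -> (forall x, vanish n (L x)) ->
  forall x, L x n = L (fps_const (x 0%N)) n.
Proof.
move=> LL L0 x; rewrite {1}[x]fps_split LL fps_addE fps_t_scaleE.
by case: n L0 => [|n] L0; rewrite ?[L _ n]L0 ?add0r.
Qed.

Lemma leading_coef_linear (V W : lmodType R) (L : fps V -> fps W) n :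
  linear_for (@GRing.scale (fps R) (fps W)) L ->
  linear (fun a => L (fps_const a) n).
Proof.
move=> LL c a b.
rewrite -(fps_const_scaleE c (L (fps_const a)) n) -fps_addE -LL.
congr (L _ n).
apply/funext => m; rewrite fps_addE fps_const_scaleE.
by case: m => [|m] //=; rewrite scaler0 addr0.
Qed.

End Leading.

(** * Primitives of 2-cocycles *)

Section Primitive.

Lemma sum_card0 (W : zmodType) n (G : {set 'I_n} -> W) :
  \sum_(S : {set 'I_n} | #|S| == 0%N) G S = G set0.
Proof. by apply: big_pred1 => S; rewrite cards_eq0. Qed.

Lemma sum_card1 (W : zmodType) n (G : {set 'I_n} -> W) :
  \sum_(S : {set 'I_n} | #|S| == 1%N) G S = \sum_i G [set i].
Proof.
rewrite -(big_imset (h := @set1 _) (A := predT)) /=; last first.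
  by move=> i j _ _ /set1_inj.
apply: eq_bigl => S; apply/cards1P/imsetP => [[i ->]|[i _ ->]]; by exists i.
Qed.

Variables (k : fieldType) (A : lmodType k) (lam : k).
Variables (mu : A -> A -> A) (T : A -> A).
Hypothesis rbA : rota_baxter lam mu T.

(** The conditions for [(mu + E t, T + F t)] to be a Rota-Baxter structure
    modulo [t^2]: 2-cocycles with all terms on the side where they come without
    signs. *)
Definition infinitesimal_deformation (E : A -> A -> A) (F : A -> A) : Prop :=
  [/\ bilinear_for *:%R *:%R E,
      linear F,
      forall a b c, E (mu a b) c + mu (E a b) c = E a (mu b c) + mu a (E b c)
    & forall a b, E (T a) (T b) + mu (F a) (T b) + mu (T a) (F b) =
       F (mu a (T b) + mu (T a) b + lam *: mu a b) +
       T (E a (T b) + E (T a) b + lam *: E a b + mu a (F b) + mu (F a) b)].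

Definition pair_cochain (E : A -> A -> A) (F : A -> A) : rba_space A 2 :=
  (fun a : {ffun 'I_2 -> A} => E (a ord0) (a (lift ord0 ord0)),
   fun a : {ffun 'I_1 -> A} => F (a ord0)).

(** Replaces the various ordinals naming the same position by natural numbers,
    which simplification can compare. *)
Lemma fun_of_ord n (a : {ffun 'I_n -> A}) :
  exists a' : nat -> A, forall i, a i = a' i.
Proof.
exists (fun m => if insub m is Some i then a i else 0) => i.
by rewrite valK.
Qed.

Lemma pair_cochain_multilinear E F :
  bilinear_for *:%R *:%R E -> linear F -> rba_cochain (pair_cochain E F).
Proof.
move=> [El Er] FL; split=> a i /= c x y.
  rewrite !ffunE; have [/eqP|] := boolP (ord0 == i).
    by move=> <- /=; apply: El.
  by case: i => [[|[|//]] //] lti _; rewrite /eq_op /=; apply: Er.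
by rewrite !ffunE (ord1 i) /=; apply: FL.
Qed.

Lemma scaler_signE n (v : A) : (-1) ^+ n *: v = if odd n then - v else v.
Proof. by rewrite -signr_odd scaler_sign. Qed.

Lemma pair_cochain_cocycle E F :
  infinitesimal_deformation E F ->
  rba_cocycle lam mu T (pair_cochain E F).
Proof.
move=> [EB FL asE rbE]; split; first exact: pair_cochain_multilinear.
have [_ _ TL _] := rbA.
rewrite /= /delta /partial /hochschild /pair_cochain /=.
congr pair; apply/funext => a; have [a' aE] := fun_of_ord a.
  rewrite !big_ord_recl big_ord0 !ffunE /= !aE !scaler_signE /= addr0.
  have /eqP := asE (a' 0%N) (a' 1%N) (a' 2%N); rewrite -subr_eq0 => /eqP <-.
  by rewrite opprD [LHS](AC ((1*2)*1) ((2*4)*(3*1))).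
rewrite /Phi !big_ord_recl !big_ord0 !sum_card0 sum_card1.
rewrite !big_ord_recl !big_ord0 !ffunE /= !aE !inE !scaler_signE /=.
have := rbE (a' 0%N) (a' 1%N).
rewrite !(linear_funD TL) (linear_funZ TL) => /eqP.
rewrite -subr_eq0 => /eqP rb0.
rewrite !addr0 expr1 expr0 scale1r -opprD; apply/eqP; rewrite oppr_eq0.
rewrite -[X in _ == X]rb0 /rhd /lhd /star !opprD; apply/eqP.
rewrite -[bump 0 0]/1%N.
by rewrite [RHS](AC (3*(1*5)) ((3*8*4)*(2*9)*(1*(7*(6*5))))).
Qed.

(** A primitive [(b, c)] in the complex has a second component [c], an element
    of [A]; it is traded for the inner derivation [a |-> c a - a c], which is
    killed by [delta] and mapped by [Phi] to the differential of [c]. *)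
Lemma primitive_exists E F :
  rba_cohomology_zero lam mu T 2 ->
  infinitesimal_deformation E F ->
  exists h : A -> A,
  [/\ linear h, forall a b, E a b = mu (h a) b + mu a (h b) - h (mu a b)
     & forall a, F a = T (h a) - h (T a)].
Proof.
move=> H2 EF.
have [[muL muR] muA TL _] := rbA.
have [[b c] [/= bL _] [bE cF]] := H2 _ (pair_cochain_cocycle EF).
pose g := c [ffun j => 0].
pose d a := b [ffun=> a].
have const1E (a : {ffun 'I_1 -> A}) w : a ord0 = w -> b a = d w.
  by move=> <-; congr b; apply/ffunP => j; rewrite ffunE (ord1 j).
exists (fun a => d a + (mu g a - mu a g)); split.
- have dL : linear d.
    have bE1 w : b [ffun j => if j == ord0 then w else [ffun=> 0 : A] j] = d w.
      by apply: const1E; rewrite ffunE eqxx.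
    by move=> r u v; rewrite -!bE1; apply: bL.
  move=> r u v; rewrite dL muL muR !scalerDr scalerN !opprD.
  by rewrite [LHS](AC (2*(2*2)) ((1*(3*5))*(2*(4*6)))).
- move=> u v.
  have := congr1 (fun f => f [ffun j : 'I_2 => if j == ord0 then u else v]) bE.
  rewrite /= !ffunE /= => <-.
  rewrite /delta /hochschild !big_ord_recl !big_ord0 !scaler_signE /= addr0.
  rewrite (const1E _ v); last by rewrite !ffunE.
  rewrite (const1E _ (mu u v)); last by rewrite !ffunE.
  rewrite (const1E _ u); last by rewrite !ffunE.
  rewrite (linear_funD (muL v)) (linear_funB (muL v)).
  rewrite (linear_funD (muR u)) (linear_funB (muR u)) !muA !opprD !opprK.
  (* The terms of the inner derivation, grouped into three cancelling pairs. *)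
  rewrite [RHS](AC ((1*2)*(1*2)*(1*2)) ((4*7*1)*((2*8)*((5*3)*(9*6))))).
  by rewrite /= !subrr !addr0 !ffunE.
move=> u; have := congr1 (fun f => f [ffun j : 'I_1 => u]) cF.
rewrite /= !ffunE /= => <-.
rewrite /partial /hochschild /Phi !big_ord_recl !big_ord0 !sum_card0.
rewrite !ffunE scaler_signE /= expr0 scale1r !addr0.
rewrite (const1E _ (T u)); last by rewrite !ffunE.
rewrite (const1E _ u); last by rewrite !ffunE inE.
(* There is only one family indexed by the empty type. *)
have cE w : c w = g by congr c; apply/ffunP => - [].
rewrite !cE /rhd /lhd (linear_funD TL) (linear_funB TL).
rewrite !opprD !opprK.
by rewrite [LHS](AC (2*2*2) (6*(4*2)*(5*(3*1)))).
Qed.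

End Primitive.

(** * The Rota-Baxter structure on constant coefficients *)

Section Defect.
Variables (k : fieldType) (A : lmodType k) (lam : k).
Variables (mu : A -> A -> A) (T : A -> A).
Hypothesis rbA : rota_baxter lam mu T.

Let muL v : linear (mu^~ v).
Proof. by case: rbA => [[h _] _ _ _]; apply: h. Qed.
Let muR v : linear (mu v).
Proof. by case: rbA => [[_ h] _ _ _]; apply: h. Qed.
Let muA : associative mu. Proof. by case: rbA. Qed.
Let TL : linear T. Proof. by case: rbA. Qed.

Local Notation "x ** y" := (cauchy mu x y) (at level 40, left associativity).
Local Notation Tc := (fun x : fps A => (fun n => T (x n)) : fps A).

Lemma const_mulL y : linear ((fun x => x ** y) : fps A -> fps A).
Proof. by apply: cauchy_linearl => i; apply: muL. Qed.

Lemma const_mulR x : linear ((fun y => x ** y) : fps A -> fps A).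
Proof. exact: (cauchy_linearr (fun i => muR (x i))). Qed.

Lemma const_mulA : associative (cauchy mu).
Proof.
apply: cauchy_assoc muA => v; first exact: linear_funD (muR v).
exact: linear_funD (muL v).
Qed.

Lemma const_op_linear : linear (Tc : fps A -> fps A).
Proof.
move=> a x y; apply/funext => n; rewrite !fps_addE (linear_funD TL).
congr (_ + _); rewrite [LHS](linear_fun_sum TL).
by apply: eq_bigr => i _; rewrite (linear_funZ TL).
Qed.

Lemma const_rota_baxter x y :
  Tc x ** Tc y = Tc (x ** Tc y + Tc x ** y + fps_const lam *: (x ** y)).
Proof.
have [_ _ _ rb] := rbA.
apply/funext => n; rewrite !fps_addE fps_const_scaleE /cauchy.
rewrite scaler_sumr -!big_split /= (linear_fun_sum TL).
by apply: eq_bigr => i _; rewrite rb.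
Qed.

Lemma const_mul_leadl n u y : vanish n u -> (u ** y) n = mu (u n) (y 0%N).
Proof.
move=> u0; rewrite /cauchy big_ord_recr /= subnn big1 ?add0r // => i _.
by rewrite u0 // (linear_fun0 (muL _)).
Qed.

Lemma const_mul_leadr n u y : vanish n u -> (y ** u) n = mu (y 0%N) (u n).
Proof.
move=> u0; rewrite /cauchy big_ord_recl subn0 big1 ?addr0 // => i _.
rewrite u0 ?(linear_fun0 (muR _)) // ltn_subrL lift0 /=.
exact: leq_ltn_trans (ltn_ord i).
Qed.

Lemma vanish_const_mull n u y : vanish n u -> vanish n (u ** y).
Proof.
move=> u0 m lt_mn; have u0m := vanishW (ltnW lt_mn) u0.
by rewrite const_mul_leadl // u0 // (linear_fun0 (muL _)).
Qed.

Lemma vanish_const_mulr n u y : vanish n u -> vanish n (y ** u).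
Proof.
move=> u0 m lt_mn; have u0m := vanishW (ltnW lt_mn) u0.
by rewrite const_mul_leadr // u0 // (linear_fun0 (muR _)).
Qed.

Lemma ext1_linear (psi : nat -> A -> A) :
  (forall i, linear (psi i)) -> linear (ext1 psi : fps A -> fps A).
Proof. exact: cauchy_linearr. Qed.

Lemma ext1_id0 (psi : nat -> A -> A) x : ext1 psi x 0%N = psi 0%N (x 0%N).
Proof. by rewrite /ext1 /cauchy big_ord1. Qed.

Lemma ext2_0 (F : nat -> A -> A -> A) x y :
  ext2 F x y 0%N = F 0%N (x 0%N) (y 0%N).
Proof. by rewrite /ext2 /cauchy !big_ord1. Qed.

(** Series of maps that agree below order [n] differ at order [n] only through
    their [n]th maps, applied to the constant term. *)
Lemma ext1_perturb n (psi psi' : nat -> A -> A) x :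
  (forall i, (i < n)%N -> psi' i = psi i) ->
  vanish n (ext1 psi' x - ext1 psi x) /\
  (ext1 psi' x - ext1 psi x) n = psi' n (x 0%N) - psi n (x 0%N).
Proof.
move=> eq_psi.
split=> [m lt_mn|]; rewrite fps_subE /ext1 /cauchy.
  apply/eqP; rewrite subr_eq0; apply/eqP/eq_bigr => i _.
  by rewrite eq_psi // (leq_trans (ltn_ord i)).
rewrite !big_ord_recr /= !subnn opprD addrACA -[RHS]add0r; congr (_ + _).
by apply/eqP; rewrite subr_eq0; apply/eqP/eq_bigr => i _; rewrite eq_psi.
Qed.

(** * Defects and obstructions *)

Variables (mu_ : nat -> A -> A -> A) (T_ : nat -> A -> A).
Hypothesis defA : formal_deformation lam mu T mu_ T_.

Let mu_0 : mu_ 0%N = mu. Proof. by case: defA. Qed.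
Let T_0 : T_ 0%N = T. Proof. by case: defA. Qed.
Let rbt : @rota_baxter (fps k) (fps A) (fps_const lam) (ext2 mu_) (ext1 T_).
Proof. by case: defA. Qed.

Local Notation mt := (ext2 mu_).
Local Notation Tt := (ext1 T_).

Definition defect2 (psi : nat -> A -> A) (x y : fps A) : fps A :=
  ext1 psi (mt x y) - ext1 psi x ** ext1 psi y.

Definition defect1 (psi : nat -> A -> A) (x : fps A) : fps A :=
  ext1 psi (Tt x) - Tc (ext1 psi x).

Definition solves_below n (psi : nat -> A -> A) : Prop :=
  [/\ forall i, linear (psi i), psi 0%N = id,
      forall x y, vanish n (defect2 psi x y)
    & forall x, vanish n (defect1 psi x)].

Section DefectLinear.
Variable psi : nat -> A -> A.
Hypothesis psiL : forall i, linear (psi i).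

Let PL := ext1_linear psiL.

Lemma defect2_linearl y : linear ((defect2 psi)^~ y).
Proof.
have [[mtL _] _ _ _] := rbt.
apply: linear_sub_fun; first exact: linear_comp_fun PL (mtL y).
exact: linear_comp_fun (const_mulL (ext1 psi y)) PL.
Qed.

Lemma defect2_linearr x : linear (defect2 psi x).
Proof.
have [[_ mtR] _ _ _] := rbt.
apply: linear_sub_fun; first exact: linear_comp_fun PL (mtR x).
exact: linear_comp_fun (const_mulR (ext1 psi x)) PL.
Qed.

Lemma defect1_linear : linear (defect1 psi).
Proof.
have [_ _ TtL _] := rbt.
apply: linear_sub_fun; first exact: linear_comp_fun PL TtL.
exact: linear_comp_fun const_op_linear PL.
Qed.

Lemma ext1_mul x y :
  ext1 psi (mt x y) = defect2 psi x y + ext1 psi x ** ext1 psi y.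
Proof. by rewrite subrK. Qed.

Lemma ext1_op x : ext1 psi (Tt x) = defect1 psi x + Tc (ext1 psi x).
Proof. by rewrite subrK. Qed.

End DefectLinear.

Section Obstruction.
Variables (n : nat) (psi : nat -> A -> A).
Hypothesis solves : solves_below n psi.

Let psiL i : linear (psi i). Proof. by case: solves. Qed.
Let D0 x y : vanish n (defect2 psi x y). Proof. by case: solves. Qed.
Let G0 x : vanish n (defect1 psi x). Proof. by case: solves. Qed.
Let psi0 : psi 0%N = id. Proof. by case: solves. Qed.

Definition obstruction2 a b := defect2 psi (fps_const a) (fps_const b) n.
Definition obstruction1 a := defect1 psi (fps_const a) n.

Lemma obstruction2E x y : defect2 psi x y n = obstruction2 (x 0%N) (y 0%N).
Proof.
rewrite (leading_coef (defect2_linearl psiL y)); last by move=> z; apply: D0.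
by rewrite (leading_coef (defect2_linearr psiL _)).
Qed.

Lemma obstruction1E x : defect1 psi x n = obstruction1 (x 0%N).
Proof. by rewrite (leading_coef (defect1_linear psiL)). Qed.

Lemma obstruction2_bilinear : bilinear_for *:%R *:%R obstruction2.
Proof.
split=> a.
  exact: (leading_coef_linear n (defect2_linearl psiL (fps_const a))).
exact: (leading_coef_linear n (defect2_linearr psiL (fps_const a))).
Qed.

Lemma obstruction1_linear : linear obstruction1.
Proof. exact: (leading_coef_linear n (defect1_linear psiL)). Qed.

Let P0 x : ext1 psi x 0%N = x 0%N. Proof. by rewrite ext1_id0 psi0. Qed.

(** The coefficient of [t^n] in the image under [psi] of the associativity of
    [mu_t]; the parts free of defects agree because [mu] is associative. *)
Lemma obstruction_assoc a b c :
  obstruction2 (mu a b) c + mu (obstruction2 a b) c =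
  obstruction2 a (mu b c) + mu a (obstruction2 b c).
Proof.
have [_ mtA _ _] := rbt.
have := congr1 (fun x => ext1 psi x n)
  (mtA (fps_const a) (fps_const b) (fps_const c)).
rewrite /= !ext1_mul (linear_funD (const_mulL _)) (linear_funD (const_mulR _)).
rewrite const_mulA.
rewrite !addrA => /addIr; rewrite !fps_addE !obstruction2E !ext2_0 mu_0.
rewrite (const_mul_leadl _ (D0 _ _)) (const_mul_leadr _ (D0 _ _)).
by rewrite !P0 !obstruction2E.
Qed.

(** The coefficient of [t^n] in the image under [psi] of the Rota-Baxter
    identity for [T_t]; the same identity for [T], applied to the images of [a]
    and [b], cancels all terms that involve no defect. *)
Lemma obstruction_rota_baxter a b :
  obstruction2 (T a) (T b) + mu (obstruction1 a) (T b)
    + mu (T a) (obstruction1 b) =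
     obstruction1 (mu a (T b) + mu (T a) b + lam *: mu a b) +
     T (obstruction2 a (T b) + obstruction2 (T a) b + lam *: obstruction2 a b
        + mu a (obstruction1 b) + mu (obstruction1 a) b).
Proof.
have [_ _ _ rb] := rbt; set x := fps_const a; set y := fps_const b.
have := congr1 (fun x => ext1 psi x n) (rb x y).
rewrite /= ext1_op !fps_addE obstruction1E !fps_addE fps_const_scaleE.
rewrite !(linear_funD (ext1_linear psiL)) (linear_funZ (ext1_linear psiL)).
rewrite !fps_addE fps_const_scaleE !ext1_mul !fps_addE.
(* Only one factor at a time is split, so that a product of two defects never
   arises: the other factor enters through its constant term. *)
have opL z u : (ext1 psi (Tt z) ** u) n =
    mu (obstruction1 (z 0%N)) (u 0%N) + (Tc (ext1 psi z) ** u) n.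
  rewrite ext1_op (linear_funD (const_mulL u)) fps_addE.
  by rewrite (const_mul_leadl _ (G0 _)) obstruction1E.
have opR z u : (u ** ext1 psi (Tt z)) n =
    mu (u 0%N) (obstruction1 (z 0%N)) + (u ** Tc (ext1 psi z)) n.
  rewrite ext1_op (linear_funD (const_mulR u)) fps_addE.
  by rewrite (const_mul_leadr _ (G0 _)) obstruction1E.
rewrite !opL !opR const_rota_baxter !fps_addE fps_const_scaleE !obstruction2E.
rewrite !ext2_0 !ext1_id0 psi0 mu_0 T_0 /=.
rewrite scalerDr.
set r1 := (_ ** _) n; set r2 := (_ ** _) n; set r3 := lam *: (_ ** _) n.
(* [r1], [r2], [r3] are the products of the images of [a] and [b] under [psi]
   that remain in the argument of [T] on both sides. *)
move=> eq_coef; apply: (addIr (T (r1 + r2 + r3))).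
rewrite -[RHS]addrA -(linear_funD TL).
transitivity (obstruction2 (T a) (T b) + (mu (obstruction1 a) (T b) +
   (mu (T a) (obstruction1 b) + T (r1 + r2 + r3)))).
  by rewrite !addrA.
rewrite eq_coef; congr (_ + T _).
by rewrite [LHS](AC (1*2*(1*2)*2) ((1*4*7*2*5)*(3*6*8))).
Qed.

Lemma obstruction_cocycle :
  infinitesimal_deformation lam mu T obstruction2 obstruction1.
Proof.
split; [exact: obstruction2_bilinear | exact: obstruction1_linear | |].
  exact: obstruction_assoc.
exact: obstruction_rota_baxter.
Qed.

End Obstruction.

(** * Changing and choosing the coefficients *)

Section Perturbation.
Variables (n : nat) (psi psi' : nat -> A -> A).
Hypothesis eq_psi : forall i, (i < n)%N -> psi' i = psi i.

Let U x := ext1 psi' x - ext1 psi x.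

(** Writing the change of the product as [psi x ** U y + U x ** psi' y] keeps it
    linear in [U], with no quadratic term. *)
Lemma defect2_perturb x y :
  defect2 psi' x y = defect2 psi x y +
    (U (mt x y) - (ext1 psi x ** U y + U x ** ext1 psi' y)).
Proof.
rewrite /defect2 /U (linear_funB (const_mulL _)) (linear_funB (const_mulR _)).
rewrite [_ - _ + (_ - _ ** _)]addrC subrKA opprB addrCA.
by rewrite [_ - _ ** _ + _]subrKA subrKA.
Qed.

Lemma defect1_perturb x :
  defect1 psi' x = defect1 psi x + (U (Tt x) - Tc (U x)).
Proof.
rewrite /defect1 /U (linear_funB const_op_linear).
by rewrite opprB addrCA [_ - Tc _ + _]subrKA subrKA.
Qed.

Lemma vanish_const_op (x : fps A) : vanish n x -> vanish n (Tc x).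
Proof. by move=> x0 m lt_mn; rewrite x0 ?(linear_fun0 TL). Qed.

Let U0 x : vanish n (U x). Proof. by case: (ext1_perturb x eq_psi). Qed.

Lemma defect2_local x y :
  vanish n (defect2 psi x y) -> vanish n (defect2 psi' x y).
Proof.
move=> D0; rewrite defect2_perturb; apply: vanishD => //; apply: vanishB => //.
by apply: vanishD; [apply: vanish_const_mulr|apply: vanish_const_mull].
Qed.

Lemma defect1_local x : vanish n (defect1 psi x) -> vanish n (defect1 psi' x).
Proof.
move=> G0; rewrite defect1_perturb; apply: vanishD => //; apply: vanishB => //.
exact: vanish_const_op.
Qed.

End Perturbation.

Definition add_coef (psi : nat -> A -> A) n (h : A -> A) i a :=
  if i == n then psi i a + h a else psi i a.

(** The [n]th coefficient is corrected by a primitive of the obstruction. *)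
Lemma solve_step n psi :
  rba_cohomology_zero lam mu T 2 -> (0 < n)%N -> solves_below n psi ->
  exists h, solves_below n.+1 (add_coef psi n h).
Proof.
move=> H2 n_gt0 sol; have [psiL psi0 D0 G0] := sol.
have [h [hL hE hF]] := primitive_exists rbA H2 (obstruction_cocycle sol).
exists h; set psi' := add_coef psi n h.
have eq_psi i : (i < n)%N -> psi' i = psi i.
  by move=> lt_in; apply/funext => a; rewrite /psi' /add_coef ltn_eqF.
have psi'0 : psi' 0%N = id by rewrite eq_psi.
have Un x : (ext1 psi' x - ext1 psi x) n = h (x 0%N).
  case: (ext1_perturb x eq_psi) => _ ->.
  by rewrite /psi' /add_coef eqxx addrC addKr.
have U0 x : vanish n (ext1 psi' x - ext1 psi x).
  by case: (ext1_perturb x eq_psi).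
split=> //.
- move=> i; rewrite /psi' /add_coef; case: (i == n); last exact: psiL.
  move=> c a b; rewrite psiL hL scalerDr.
  by rewrite [LHS](AC (2*2) ((1*3)*(2*4))).
- move=> x y m; rewrite ltnS leq_eqVlt => /predU1P [->|lt_mn]; last first.
    exact: (defect2_local eq_psi (D0 x y)).
  rewrite (defect2_perturb psi) fps_addE (obstruction2E sol) hE.
  rewrite fps_subE Un fps_addE.
  rewrite (const_mul_leadr _ (U0 y)) (const_mul_leadl _ (U0 x)) !Un.
  rewrite ext2_0 mu_0 !ext1_id0 psi0 psi'0 /=.
  by rewrite subrKA [X in _ - X]addrC subrr.
- move=> x m; rewrite ltnS leq_eqVlt => /predU1P [->|lt_mn]; last first.
    exact: (defect1_local eq_psi (G0 x)).
  rewrite (defect1_perturb psi) fps_addE (obstruction1E sol) hF.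
  rewrite fps_subE !Un ext1_id0 T_0.
  by rewrite subrKA subrr.
Qed.

(** The step [P m] settles the coefficients up to order [m] and later steps keep
    them, so the diagonal [P i i] is the limit. *)
Lemma full_solution : rba_cohomology_zero lam mu T 2 ->
  exists psi, forall n, solves_below n psi.
Proof.
move=> H2.
have [|H HP] := @choice (nat * (nat -> A -> A)) (A -> A) (fun p h =>
    solves_below p.1.+1 p.2 -> solves_below p.1.+2 (add_coef p.2 p.1.+1 h)).
  move=> [n psi] /=; have [sol|nsol] := pselect (solves_below n.+1 psi).
    by have [h hP] := solve_step H2 (ltn0Sn n) sol; exists h.
  by exists id.
pose fix P m := if m is m'.+1 then add_coef (P m') m (H (m', P m'))
                else fun i => if i is 0 then id else fun=> 0.
have sol m : solves_below m.+1 (P m).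
  elim: m => [|m IH]; last exact: (HP (m, P m)).
  split=> // [[|i] c a b|x y [|//] _|x [|//] _] //=.
    by rewrite scaler0 addr0.
    rewrite /defect2 fps_subE.
    by rewrite /cauchy big_ord1 !ext1_id0 /= ext2_0 mu_0 subrr.
  rewrite /defect1 fps_subE.
  by rewrite !ext1_id0 /= T_0 subrr.
have stable m i : (i <= m)%N -> P m i = P i i.
  elim: m => [|m IH]; first by rewrite leqn0 => /eqP ->.
  rewrite leq_eqVlt => /predU1P [-> //|lt_im]; rewrite -IH //.
  by apply/funext => a; rewrite /= /add_coef ltn_eqF.
pose psi i := P i i.
have agree n i : (i < n)%N -> psi i = P n i.
  by move=> lt_in; rewrite stable // ltnW.
have sol_le n : solves_below n (P n).
  have [? ? D0 G0] := sol n.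
  by split=> // [x y|x]; [apply: vanishW (D0 x y)|apply: vanishW (G0 x)].
exists psi => n; have [PL _ D0 G0] := sol_le n; split.
- by move=> i; have [PLi _ _ _] := sol i; apply: PLi.
- by [].
- by move=> x y; apply: (defect2_local (agree n)).
- by move=> x; apply: (defect1_local (agree n)).
Qed.

End Defect.

Theorem theorem6p7 (k : fieldType) (char0 : [pchar k] =i pred0)
    (A : lmodType k) (lam : k) (mu : A -> A -> A) (T : A -> A)
    (rbA : rota_baxter lam mu T)
    (H2_zero : rba_cohomology_zero lam mu T 2) :
  rigid lam mu T.
Proof.
move=> mu_ T_ defA; have [psi solves] := full_solution rbA defA H2_zero.
have [psiL psi0 _ _] := solves 0%N.
exists psi; split=> // [x y|x]; apply/funext => n;
  have [_ _ D0 G0] := solves n.+1.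
  transitivity (cauchy mu (ext1 psi x) (ext1 psi y) n).
    by apply/eqP; rewrite -subr_eq0; apply/eqP/(D0 x y).
  rewrite /ext2 big_ord_recl subn0 big1 ?addr0 // => i _.
  by rewrite /cauchy big1.
transitivity (T (ext1 psi x n)).
  by apply/eqP; rewrite -subr_eq0; apply/eqP/(G0 x).
by rewrite {2}/ext1 /cauchy big_ord_recl subn0 big1 ?addr0.
Qed.
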